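(* Let $X$ be a smooth complex projective variety and $n\ge1$. Let $x_{h_1}\succ x_{h_2}\succ\dots\succ x_{h_t}$ be distinct elements of the fixed basis $\mathcal{B}$ of $H^*(X)$ and let $m_1,\dots,m_t\ge1$ be integers with $m_1+\dots+m_t=n$. For the type $L_*=(1^{(n)})$, $H_*=(h_1^{(m_1)},h_2^{(m_2)},\dots,h_t^{(m_t)})$ there is an isomorphism of $\mathcal{S}_n$-modules $$E_0^{|H_*|}(1^{(n)},H_* )\cong\mathrm{Ind}^{\mathcal{S}_n}_{\mathcal{S}_{m_1}\times\mathcal{S}_{m_2}\times\dots\times\mathcal{S}_{m_t}}V^{\epsilon(m_1,h_1)}\otimes V^{\epsilon(m_2,h_2)}\otimes\dots\otimes V^{\epsilon(m_t,h_t)}.$$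
   Context: $X$ is connected of complex dimension $m\ge1$, $H^*(X)=H^*(X;\mathbb{Q})$, and $\mathcal{B}=\{x_1=1\prec x_2\prec\dots\prec x_B=w\}$ is a fixed homogeneous ordered basis of $H^*(X)$ with $\deg x_i$ nondecreasing, where $w\in H^{2m}(X)$ is the fundamental class. $|x_h|=\deg x_h$. $E_0^*(X,n)$, the exterior degree $0$ part of the Kriz model of $X$, is $H^*(X)^{\otimes n}=H^*(X^n)$, on which $\mathcal{S}_n$ acts by algebra automorphisms: $\sigma(p_1^*(y_1)\cdots p_n^*(y_n))=p_{\sigma(1)}^*(y_1)\cdots p_{\sigma(n)}^*(y_n)$ (product in the graded-commutative algebra $H^*(X^n)$; $p_i^*$ is the pullback along the $i$-th projection). $h^{(r)}$ means $h$ repeated $r$ times. $E_0^{|H_*|}(1^{(n)},H_* )$ is the linear span of the monomials $x_{a_1}\otimes\dots\otimes x_{a_n}=p_1^*(x_{a_1})\cdots p_n^*(x_{a_n})$ in which exactly $m_i$ of the factors are equal to $x_{h_i}$ for each $i=1,\dots,t$; it lies in degree $|H_*|=\sum_i m_i|x_{h_i}|$. $V(\lambda)$ is the irreducible module of the symmetric group attached to the partition $\lambda$ ($V(r)$ trivial, $V(1,\dots,1)$ sign), and for $r\geq 1$ $$V^{\epsilon(r,h)}=\begin{cases}V(r)&\text{if } r=1\text{ or }|x_h|\text{ is even},\\ V(1,1,\dots,1)\ (r\text{ ones})&\text{if } r\ge2\text{ and }|x_h|\text{ is odd},\end{cases}$$ an $\mathcal{S}_r$-module. $\mathcal{S}_{m_1}\times\dots\times\mathcal{S}_{m_t}\subset\mathcal{S}_n$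 is the standard Young subgroup. *)

(* Defs.v *)
From HB Require Import structures.
From mathcomp Require Import all_boot all_order all_algebra all_fingroup.
From mathcomp Require Import mxrepresentation.
From mathcomp Require Import all_classical all_reals topology normedtype.
From mathcomp Require Import complex.
From mathcomp Require mpoly.

Import Order.TTheory GRing.Theory Num.Theory numFieldNormedType.Exports.

Set Implicit Arguments.
Unset Strict Implicit.
Unset Printing Implicit Defensive.

Local Open Scope classical_set_scope.
Local Open Scope ring_scope.
Local Open Scope quotient_scope.

Section Simplex.
Variable R : realType.

Definition simplex k : set 'rV[R]_k.+1 :=
  [set t | (forall i, 0 <= t 0 i) /\ \sum_i t 0 i = 1].
Arguments simplex k : clear implicits.

(* The affine map from the k-simplex to the l-simplex sending the vertex e_i to
   e_(phi i); only the values phi i <= l for i <= k are meaningful. *)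
Definition smap_mx k l (phi : nat -> nat) : 'M[R]_(k.+1, l.+1) :=
  \matrix_(i, j) (inord (phi i) == j)%:R.

Lemma smap_mx_sum k l phi i : \sum_j smap_mx k l phi i j = 1.
Proof.
rewrite (bigD1 (inord (phi i))) //= mxE eqxx big1 ?addr0 // => j nj.
by rewrite mxE eq_sym (negbTE nj).
Qed.

Lemma smap_subproof k l phi (t : simplex k) :
  (\val t *m smap_mx k l phi) \in simplex l.
Proof.
case: t => t /= /set_mem [t0 t1]; apply/mem_set; split=> [j|].
  rewrite mxE; apply: sumr_ge0 => i _; apply: mulr_ge0 => //.
  by rewrite mxE ler0n.
rewrite -[RHS]t1; under eq_bigr do rewrite mxE.
rewrite exchange_big /=; apply: eq_bigr => i _.
by rewrite -mulr_sumr smap_mx_sum mulr1.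
Qed.

Lemma mx_continuous (T : topologicalType) m n (f : T -> 'M[R]_(m, n)) :
  (forall i j, continuous (fun x => f x i j)) -> continuous f.
Proof.
move=> cf x A [P P_nbhs PA].
have : \forall y \near x, forall i j, P i j (f y i j).
  apply: filter_forall => i; apply: filter_forall => j.
  exact: cf (P_nbhs i j).
by apply: filterS => y Py; apply: PA.
Qed.

Definition smap k l phi (t : simplex k) : simplex l :=
  exist (fun u => u \in simplex l) _ (smap_subproof l phi t).

Lemma smap_continuous k l phi : continuous (@smap k l phi).
Proof.
have cV : continuous (set_val \o @smap k l phi); last first.
  exact: (@continuous_comp_initial (simplex l) (simplex k) _ set_val).
apply: mx_continuous => i j; rewrite (_ : (fun _ => _) =
    (fun u : simplex k => \sum_h set_val u i h * smap_mx k l phi h j)).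
  apply: continuous_big => [|h _]; first exact: add_continuous.
  move=> u; apply: cvgMr_tmp; first exact: (@nbhs_filter (simplex k) u).
  have cs : continuous (set_val : simplex k -> 'rV[R]_k.+1).
    exact: initial_continuous.
  exact: (continuous_comp (cs u) (@coord_continuous R 1 k.+1 i h (set_val u))).
by apply/funext => v; rewrite /= mxE.
Qed.

End Simplex.

Arguments simplex R k : clear implicits.

Section SingularCohomology.
Variables (R : realType) (T : topologicalType).

Definition sing k := {s : simplex R k -> T | continuous s}.

Lemma sing_pull_subproof k l phi (s : sing l) :
  continuous (sval s \o @smap R k l phi).
Proof.
case: s => s cs t; apply: continuous_comp; last exact: cs.
exact: smap_continuous.
Qed.

(* s o phi_*, i.e. the face or degeneracy of s with vertices phi 0, ..., phi k *)
Definition sing_pull k l phi (s : sing l) : sing k :=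
  exist (fun f => continuous f) _ (@sing_pull_subproof k l phi s).

Definition cochain := {k : nat & sing k} -> rat^o.

Definition ev (c : cochain) k (s : sing k) : rat := c (existT _ k s).

(* The i-th face of s is obtained by precomposing with bump i, the increasing
   map omitting i. *)
Definition coboundary (c : cochain) : cochain := fun ks =>
  match ks with
  | existT 0 _ => 0
  | existT k.+1 s => \sum_(i < k.+2) (-1) ^+ i * ev c (sing_pull k (bump i) s)
  end.

(* Alexander-Whitney: front p-face [0..p] and back (k-p)-face [p..k]. *)
Definition cup_cochain (a b : cochain) : cochain := fun ks =>
  let: existT k s := ks in
  \sum_(p < k.+1) ev a (sing_pull p id s) *
                  ev b (sing_pull (k - p) (addn p) s).

Definition one_cochain : cochain := fun ks => (tag ks == 0)%N%:R.

(* A cochain lives in the direct sum (and not the product) of the groups of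
   k-cochains when it vanishes in large degree. *)
Definition bounded (c : cochain) :=
  exists N, forall k (s : sing k), (N <= k)%N -> ev c s = 0.

Definition cocycle_pred : {pred cochain} :=
  fun c => `[< bounded c /\ coboundary c = 0 >].

Lemma evD a b k (s : sing k) : ev (a + b) s = ev a s + ev b s.
Proof. by []. Qed.

Lemma evZ x a k (s : sing k) : ev (x *: a) s = x * ev a s.
Proof. by []. Qed.

Lemma evN a k (s : sing k) : ev (- a) s = - ev a s.
Proof. by []. Qed.

Lemma coboundary_linear x a b :
  coboundary (x *: a + b) = x *: coboundary a + coboundary b.
Proof.
apply/funext => -[[|k] s]; rewrite [RHS](evD (_ *: _)) evZ /ev /=.
  by rewrite mulr0 addr0.
rewrite mulr_sumr -big_split /=; apply: eq_bigr => i _.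
by rewrite evD evZ mulrDr mulrCA.
Qed.

Lemma coboundary0 : coboundary 0 = 0.
Proof.
have := coboundary_linear (- 1) 0 0.
by rewrite scaler0 addr0 scaleN1r addNr.
Qed.

Lemma bounded_linear x a b : bounded a -> bounded b -> bounded (x *: a + b).
Proof.
move=> [M aM] [N bN]; exists (maxn M N) => k s; rewrite geq_max => /andP[Mk Nk].
by rewrite evD evZ aM // bN // mulr0 addr0.
Qed.

Lemma bounded0 : bounded 0.
Proof. by exists 0. Qed.

Lemma cocycle_submod_closed : submod_closed cocycle_pred.
Proof.
split=> [|x a b]; first by apply/asboolP; split; [exact: bounded0 | exact: coboundary0].
move=> /asboolP[ba da] /asboolP[bb db]; apply/asboolP; split.
  exact: bounded_linear.
by rewrite coboundary_linear da db scaler0 addr0.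
Qed.

HB.instance Definition _ :=
  GRing.isSubmodClosed.Build rat cochain cocycle_pred cocycle_submod_closed.

Record cocycle := Cocycle { cocycle_val :> cochain; _ : cocycle_val \in cocycle_pred }.

HB.instance Definition _ := [isSub for cocycle_val].
HB.instance Definition _ := [Choice of cocycle by <:].
HB.instance Definition _ := [SubChoice_isSubLmodule of cocycle by <:].

Definition exact_pred : {pred cocycle} :=
  fun z => `[< exists2 c, bounded c & coboundary c = val z >].

Lemma exact_submod_closed : submod_closed exact_pred.
Proof.
split=> [|x a b].
  by apply/asboolP; exists 0; [exact: bounded0 | exact: coboundary0].
move=> /asboolP[c bc dc] /asboolP[c' bc' dc']; apply/asboolP.
exists (x *: c + c'); first exact: bounded_linear.
by rewrite coboundary_linear dc dc'.
Qed.

HB.instance Definition _ :=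
  GRing.isSubmodClosed.Build rat cocycle exact_pred exact_submod_closed.

Definition cohomology : Type := Quotient.quot (GRing.ZmodClosed.clone _ exact_pred _).

HB.instance Definition _ := GRing.Zmodule.on cohomology.

Definition coh_class (z : cocycle) : cohomology := \pi z.

Lemma coh_classP (z z' : cocycle) :
  coh_class z = coh_class z' <-> exists2 c, bounded c & coboundary c = val z - val z'.
Proof.
rewrite /coh_class; split=> [/eqP|zz'].
  by rewrite piE Quotient.equivE => /asboolP.
by apply/eqP; rewrite piE Quotient.equivE; apply/asboolP.
Qed.

Lemma coh_classD z z' : coh_class (z + z') = coh_class z + coh_class z'.
Proof. by rewrite /coh_class piE. Qed.

Definition coh_scale (x : rat) (y : cohomology) : cohomology :=
  coh_class (x *: generic_quotient.repr y).

Lemma coh_class_repr (y : cohomology) : coh_class (generic_quotient.repr y) = y.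
Proof. exact: reprK. Qed.

Lemma coh_classZ x z : coh_class (x *: z) = coh_scale x (coh_class z).
Proof.
have /coh_classP[c bc dc] := coh_class_repr (coh_class z).
apply/esym/coh_classP; exists (x *: c).
  by rewrite -[_ *: c]addr0; apply: bounded_linear => //; exact: bounded0.
by rewrite -[_ *: c]addr0 coboundary_linear dc coboundary0 addr0 scalerBr.
Qed.

Lemma coh_scaleA x x' y : coh_scale x (coh_scale x' y) = coh_scale (x * x') y.
Proof. by rewrite -[y]coh_class_repr -!coh_classZ scalerA. Qed.

Lemma coh_scale1 : left_id 1 coh_scale.
Proof. by move=> y; rewrite -[y]coh_class_repr -coh_classZ scale1r. Qed.

Lemma coh_scaleDr : right_distributive coh_scale +%R.
Proof.
move=> x y y'; rewrite -[y]coh_class_repr -[y']coh_class_repr.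
by rewrite -coh_classD -!coh_classZ scalerDr coh_classD.
Qed.

Lemma coh_scaleDl y : {morph coh_scale^~ y : x x' / x + x'}.
Proof. by move=> x x'; rewrite -[y]coh_class_repr -!coh_classZ scalerDl coh_classD. Qed.

HB.instance Definition _ := GRing.Zmodule_isLmodule.Build rat cohomology
  coh_scaleA coh_scale1 coh_scaleDr coh_scaleDl.

(* y is homogeneous of degree d, i.e. comes from H^d(T; Q) *)
Definition homogeneous d (y : cohomology) :=
  exists2 z : cocycle, y = coh_class z & forall k (s : sing k), k != d -> ev z s = 0.

Lemma eq_sing_pull k l phi psi (s : sing l) :
  (forall i, (i <= k)%N -> phi i = psi i) -> sing_pull k phi s = sing_pull k psi s.
Proof.
move=> e; apply: eq_exist; apply/funext => t /=; congr (sval s _).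
apply: val_inj => /=; congr (_ *m _); apply/matrixP => i j; rewrite !mxE.
by rewrite e // -ltnS.
Qed.

Lemma sing_pullK k l n phi psi (s : sing n) :
  (forall i, (i <= k)%N -> (phi i <= l)%N) ->
  sing_pull k phi (sing_pull l psi s) = sing_pull k (psi \o phi) s.
Proof.
move=> le_phi; apply: eq_exist; apply/funext => t /=; congr (sval s _).
apply: val_inj => /=; rewrite -mulmxA; congr (_ *m _).
apply/matrixP => i j; rewrite !mxE (bigD1 (inord (phi i))) //= big1 => [|h nh].
  rewrite !mxE eqxx mul1r addr0 inordK // ltnS le_phi // -ltnS.
  exact: ltn_ord.
by rewrite !mxE eq_sym (negbTE nh) mul0r.
Qed.

Lemma evdS c k (s : sing k.+1) :
  ev (coboundary c) s = \sum_(i < k.+2) (-1) ^+ i * ev c (sing_pull k (bump i) s).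
Proof. by []. Qed.

Lemma evd0 c (s : sing 0) : ev (coboundary c) s = 0.
Proof. by []. Qed.

Lemma ev_cup a b k (s : sing k) : ev (cup_cochain a b) s =
  \sum_(p < k.+1) ev a (sing_pull p id s) * ev b (sing_pull (k - p) (addn p) s).
Proof. by []. Qed.

Definition sgn_cochain (a : cochain) : cochain :=
  fun ks => (-1) ^+ tag ks * ev a (tagged ks).

Lemma ev_sgn a k (s : sing k) : ev (sgn_cochain a) s = (-1) ^+ k * ev a s.
Proof. by []. Qed.

Lemma leibniz a b : coboundary (cup_cochain a b) =
  cup_cochain (coboundary a) b + cup_cochain (sgn_cochain a) (coboundary b).
Proof.
apply/funext => -[[|k] s]; rewrite -!/(ev _ s) evD.
  by rewrite evd0 !ev_cup !big_ord1 (evd0 a) (evd0 b) mul0r mulr0 addr0.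
pose A p phi := ev a (sing_pull p phi s).
pose B p phi := ev b (sing_pull p phi s).
have eA p phi psi : (forall i, (i <= p)%N -> phi i = psi i) -> A p phi = A p psi.
  by move=> e; rewrite /A (eq_sing_pull _ e).
have eB p phi psi : (forall i, (i <= p)%N -> phi i = psi i) -> B p phi = B p psi.
  by move=> e; rewrite /B (eq_sing_pull _ e).
have bumpS p i j : (i <= p)%N -> (bump j i <= p.+1)%N.
  by rewrite /bump => ip; case: (j <= i)%N; rewrite ?add1n ?add0n ?ltnS // leqW.
rewrite evdS.
transitivity (\sum_(i < k.+2) \sum_(p < k.+1)
   (-1) ^+ i * A p (bump i) * B (k - p)%N (fun j => bump i (p + j))).
  apply: eq_bigr => i _; rewrite ev_cup mulr_sumr; apply: eq_bigr => p _.
  have pk : (p <= k)%N by rewrite -ltnS.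
  rewrite mulrA !sing_pullK //= => j jk; first by rewrite -leq_subRL.
  exact: leq_trans jk pk.
rewrite exchange_big /=.
transitivity (\sum_(p < k.+1) \sum_(i < p.+2)
     (-1) ^+ i * A p (bump i) * B (k - p)%N (addn p.+1) +
   \sum_(p < k.+1) \sum_(j < (k - p).+2)
     (-1) ^+ (p + j) * A p id * B (k - p)%N (fun h => p + bump j h)%N); last first.
  congr (_ + _).
    rewrite ev_cup [RHS]big_ord_recl evd0 mul0r add0r; apply: eq_bigr => p _.
    rewrite (evdS a) mulr_suml; apply: eq_bigr => i _; rewrite sing_pullK //.
    by move=> j jp; exact: bumpS.
  rewrite ev_cup [RHS]big_ord_recr /=.
  have -> : ev (coboundary b) (sing_pull (k.+1 - k.+1) (addn k.+1) s) = 0.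
    by move: (sing_pull _ _ _); rewrite subnn => s'; exact: evd0.
  rewrite mulr0 addr0; apply: eq_bigr => p _.
  have pk : (p <= k)%N by rewrite -ltnS.
  rewrite ev_sgn.
  have -> : ev (coboundary b) (sing_pull (k.+1 - p) (addn p) s) =
     \sum_(j < (k - p).+2) (-1) ^+ j * B (k - p)%N (fun h => p + bump j h)%N.
    rewrite subSn // evdS; apply: eq_bigr => j _.
    by rewrite sing_pullK // => h hp; exact: bumpS.
  rewrite mulr_sumr; apply: eq_bigr => j _.
  by rewrite exprD !mulrA; congr (_ * _); rewrite -!mulrA; congr (_ * _); rewrite mulrC.
rewrite -big_split /=; apply: eq_bigr => p _.
have pk : (p <= k)%N by rewrite -ltnS.
rewrite [X in _ = X + _]big_ord_recr [X in _ = _ + X]big_ord_recl /= addn0.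
rewrite [RHS]addrA -[X in _ = X + _]addrA.
have -> : (-1) ^+ p.+1 * A p (bump p.+1) * B (k - p)%N (addn p.+1) +
   (-1) ^+ p * A p id * B (k - p)%N (fun h => p + bump 0 h)%N = 0.
  rewrite (eA p (bump p.+1) id) => [|i ip]; last by rewrite /bump ltnNge ip.
  rewrite (eB _ (fun h => _) (addn p.+1)) => [|i _]; last first.
    by rewrite /bump leq0n addSn add1n addnS.
  by rewrite exprS !mulN1r !mulNr addNr.
rewrite addr0.
rewrite -(big_mkord xpredT (fun i => (-1) ^+ i * A p (bump i) *
   B (k - p)%N (fun j => bump i (p + j)%N))).
rewrite (@big_cat_nat _ _ _ p.+1) //=; last by rewrite ltnS (leq_trans pk).
congr (_ + _).
  rewrite big_mkord; apply: eq_bigr => i _; congr (_ * _); apply: eB => j _.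
  have ip : (i <= p + j)%N by rewrite (leq_trans _ (leq_addr _ _)) // -ltnS.
  by rewrite /bump ip add1n addSn.
rewrite -{1}[p.+1]add0n big_addn subSS subSn // big_mkord.
apply: eq_bigr => j _; rewrite (_ : bump 0 j = j.+1) //.
rewrite (_ : (j + p.+1 = p + j.+1)%N); last by rewrite addnS addnC addnS.
congr (_ * _ * _).
  apply: eA => i ip; rewrite /bump leqNgt (leq_ltn_trans ip) //.
  by rewrite addnS ltnS leq_addr.
apply: eB => i _; rewrite /bump leq_add2l.
by case: (j.+1 <= i)%N; rewrite ?add1n ?add0n ?addnS.
Qed.

Lemma sgn_cochainK : involutive sgn_cochain.
Proof.
by move=> a; apply/funext => -[k s]; rewrite -!/(ev _ s) !ev_sgn signrMK.
Qed.

Lemma coboundary_sgn a : coboundary (sgn_cochain a) = - sgn_cochain (coboundary a).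
Proof.
apply/funext => -[[|k] s]; rewrite -!/(ev _ s).
  by rewrite evN ev_sgn !evd0 mulr0 oppr0.
rewrite evN ev_sgn !evdS exprS mulN1r mulNr opprK mulr_sumr.
by apply: eq_bigr => i _; rewrite ev_sgn mulrCA.
Qed.

Lemma cup_cochainDl a a' b :
  cup_cochain (a + a') b = cup_cochain a b + cup_cochain a' b.
Proof.
apply/funext => -[k s]; rewrite -!/(ev _ s) evD !ev_cup -big_split /=.
by apply: eq_bigr => p _; rewrite evD mulrDl.
Qed.

Lemma cup_cochainDr a b b' :
  cup_cochain a (b + b') = cup_cochain a b + cup_cochain a b'.
Proof.
apply/funext => -[k s]; rewrite -!/(ev _ s) evD !ev_cup -big_split /=.
by apply: eq_bigr => p _; rewrite evD mulrDr.
Qed.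

Lemma cup_cochain0l b : cup_cochain 0 b = 0.
Proof. by apply: (addrI (cup_cochain 0 b)); rewrite -cup_cochainDl !addr0. Qed.

Lemma cup_cochain0r a : cup_cochain a 0 = 0.
Proof. by apply: (addrI (cup_cochain a 0)); rewrite -cup_cochainDr !addr0. Qed.

Lemma bounded_cup a b : bounded a -> bounded b -> bounded (cup_cochain a b).
Proof.
move=> [M aM] [N bN]; exists (M + N)%N => k s MNk; rewrite ev_cup big1 // => p _.
have [/aM->|pM] := leqP M p; first by rewrite mul0r.
rewrite [X in _ * X]bN ?mulr0 // -(leq_add2l p) subnKC; last by rewrite -ltnS.
by rewrite (leq_trans _ MNk) // leq_add2r ltnW.
Qed.

Lemma cocycle_bounded (z : cocycle) : bounded z.
Proof. by case: z => z /= /asboolP[]. Qed.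

Lemma cocycle_coboundary (z : cocycle) : coboundary z = 0.
Proof. by case: z => z /= /asboolP[]. Qed.

Lemma cup_cocycle_subproof (z z' : cocycle) : cup_cochain z z' \in cocycle_pred.
Proof.
apply/asboolP; split; first by apply: bounded_cup; exact: cocycle_bounded.
by rewrite leibniz !cocycle_coboundary cup_cochain0l cup_cochain0r addr0.
Qed.

Definition cup_cocycle (z z' : cocycle) := Cocycle (cup_cocycle_subproof z z').

Lemma one_cocycle_subproof : one_cochain \in cocycle_pred.
Proof.
apply/asboolP; split; first by exists 1%N => -[].
apply/funext => -[[|[|k]] s] //; rewrite -/(ev _ s) evdS.
  by rewrite !big_ord_recl big_ord0 /ev /= expr0 expr1 !mulr1 addr0 addrN.
by rewrite big1 // => i _; rewrite /ev mulr0.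
Qed.

Definition one_cocycle := Cocycle one_cocycle_subproof.

Definition cup (y y' : cohomology) : cohomology :=
  coh_class (cup_cocycle (generic_quotient.repr y) (generic_quotient.repr y')).

Definition coh_one : cohomology := coh_class one_cocycle.

Lemma coh_classM z z' : cup (coh_class z) (coh_class z') = coh_class (cup_cocycle z z').
Proof.
have /coh_classP[c bc dc] := coh_class_repr (coh_class z).
have /coh_classP[c' bc' dc'] := coh_class_repr (coh_class z').
rewrite /cup; move: (generic_quotient.repr _) dc => z1 dc.
move: (generic_quotient.repr _) dc' => z1' dc'.
apply/coh_classP; exists (cup_cochain c z1' + cup_cochain (sgn_cochain z) c').
  rewrite -[X in X + _]scale1r; apply: bounded_linear; apply: bounded_cup => //.
    exact: cocycle_bounded.
  by have [M zM] := cocycle_bounded z; exists M => k s Mk; rewrite ev_sgn zM ?mulr0.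
rewrite -[X in coboundary (X + _)]scale1r coboundary_linear scale1r !leibniz.
rewrite sgn_cochainK coboundary_sgn !cocycle_coboundary cup_cochain0r addr0.
have -> : sgn_cochain 0 = 0.
  by apply/funext => -[k s]; rewrite -!/(ev _ s) ev_sgn mulr0.
rewrite oppr0 cup_cochain0l add0r dc dc' /=.
have cupBl a a' b : cup_cochain (a - a') b = cup_cochain a b - cup_cochain a' b.
  by apply/eqP; rewrite -subr_eq opprK -cup_cochainDl subrK.
have cupBr a b b' : cup_cochain a (b - b') = cup_cochain a b - cup_cochain a b'.
  by apply/eqP; rewrite -subr_eq opprK -cup_cochainDr subrK.
by rewrite cupBl cupBr addrA subrK.
Qed.

(* w generates the image of H^d(T; Z) in H^d(T; Q). For a closed connected
   oriented d-manifold T this characterises the fundamental class up to sign. *)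
Definition fundamental_class d (w : cohomology) :=
  let integral_class (y : cohomology) := exists2 z : cocycle, y = coh_class z &
    forall k (s : sing k), ev z s \is a Num.int /\ (k != d -> ev z s = 0) in
  integral_class w /\
  forall y, integral_class y -> exists c : int, y = c%:~R *: w.

End SingularCohomology.

(* R[i] seen as a numClosedFieldType, from which it inherits the topology of
   its norm. *)
Definition Cx (R : realType) : numClosedFieldType := R[i].

Section ProjectiveVariety.
Variables (R : realType) (N : nat).
Local Notation C := (Cx R).
Local Notation polynomials := (mpoly.mpoly N.+1 C).

Definition punctured : set 'rV[C]_N.+1 := [set v | v != 0].

(* Equality of row spaces: two nonzero vectors are related iff they span the
   same line. *)
Definition same_line (u v : punctured) : bool := (set_val u == set_val v)%MS.

Lemma same_line_equiv : equiv_class_of same_line.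
Proof.
split=> [u|u v|v u w]; rewrite /same_line.
- by rewrite submx_refl.
- by rewrite andbC.
- move=> /andP[uv vu] /andP[vw wv].
  by rewrite (submx_trans uv vw) (submx_trans wv vu).
Qed.

Canonical same_line_equivRel := EquivRelPack same_line_equiv.

Definition projective_space : topologicalType :=
  quotient_topology {eq_quot same_line}.

Definition coordinates (P : projective_space) : 'I_N.+1 -> C :=
  (set_val (@generic_quotient.repr _ {eq_quot same_line} P) : 'rV[C]_N.+1) 0.

Definition homogeneous_poly (f : polynomials) :=
  exists d, all (fun mon => mpoly.mdeg mon == d) (mpoly.msupp f).

(* Well defined for homogeneous f. *)
Definition vanishes f P := mpoly.meval (coordinates P) f = 0.

Definition in_ideal (X : set projective_space) f :=
  homogeneous_poly f /\ forall P, X P -> vanishes f P.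

(* X is Zariski closed, and at each point the common kernel in C^(N+1) of the
   differentials of all homogeneous polynomials vanishing on X, which is the
   affine cone over the projective tangent space, has dimension m + 1. *)
Record smooth_projective_variety (m : nat) (X : set projective_space) : Prop := {
  variety_algebraic : exists2 F : set polynomials, F `<=` homogeneous_poly &
    X = [set P | forall f, F f -> vanishes f P];
  variety_smooth : forall P, X P -> exists2 U : 'M[C]_(m.+1, N.+1), row_free U &
    forall u : 'rV[C]_N.+1, (u <= U)%MS <-> forall f, in_ideal X f ->
      \sum_j u 0 j * mpoly.meval (coordinates P) (mpoly.mderiv j f) = 0;
  variety_nonempty : X !=set0;
  variety_connected : connected X
}.

End ProjectiveVariety.

Section TensorPower.
Variables (H : lmodType rat) (mul : H -> H -> H) (one : H).
Variables (B : nat) (x : 'I_B -> H) (deg : 'I_B -> nat).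

Definition is_basis :=
  forall y, exists! c : {ffun 'I_B -> rat}, y = \sum_i c i *: x i.

Definition coord (y : H) : {ffun 'I_B -> rat} :=
  xget 0 [set c : {ffun 'I_B -> rat} | y = \sum_i c i *: x i].

Variable n : nat.

(* The n-th tensor power of the space with basis x, through its coordinates in
   the basis of the x_(a 0) (x) ... (x) x_(a (n - 1)). *)
Definition tensor_power := {ffun {ffun 'I_n -> 'I_B} -> rat^o}.

Definition tensor (y : 'I_n -> H) : tensor_power :=
  [ffun a : {ffun 'I_n -> 'I_B} => \prod_i coord (y i) (a i)].

(* Product of the graded tensor product: moving the j-th factor of the second
   tensor to the left of the i-th factor of the first one, for j < i, costs the
   Koszul sign. *)
Definition koszul (a c : {ffun 'I_n -> 'I_B}) : rat :=
  \prod_(i < n) \prod_(j < n | (j < i)%N) (-1) ^+ (deg (a i) * deg (c j)).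

Definition tensor_mul (u v : tensor_power) : tensor_power :=
  \sum_a \sum_c (u a * v c * koszul a c) *: tensor (fun i => mul (x (a i)) (x (c i))).

Definition tensor_one : tensor_power := tensor (fun=> one).

(* p_i^* y *)
Definition insertion (i : 'I_n) (y : H) : tensor_power :=
  tensor (fun j => if j == i then y else one).

(* p_(s 0)^*(x_(a 0)) ... p_(s (n - 1))^*(x_(a (n - 1))) *)
Definition permuted_monomial (s : 'S_n) (a : {ffun 'I_n -> 'I_B}) : tensor_power :=
  \big[tensor_mul/tensor_one]_(i < n) insertion (s i) (x (a i)).

Definition monomial (a : {ffun 'I_n -> 'I_B}) : tensor_power :=
  \big[tensor_mul/tensor_one]_(i < n) insertion i (x (a i)).

(* Linear extension of monomial a |-> permuted_monomial s a. The composition of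
   'S_n being (s * s') i = s' (s i), this is a right action of 'S_n, i.e. a left
   action for the usual composition of permutations. *)
Definition perm_act (s : 'S_n) (u : tensor_power) : tensor_power :=
  \sum_a u a *: permuted_monomial s a.

(* The words containing h i exactly mult i times. *)
Definition words t (h : 'I_t -> 'I_B) (mult : 'I_t -> nat) : {set {ffun 'I_n -> 'I_B}} :=
  finset (fun a : {ffun 'I_n -> 'I_B} =>
    [forall i : 'I_t, #|finset (fun j => a j == h i)| == mult i]).

(* E_0(1^(n), H_* ) for H_* = (h_1^(m_1), ..., h_t^(m_t)). The monomials in a
   fixed set of words being homogeneous of the same degree |H_*|, the degree is
   not mentioned. *)
Definition typed_span t (h : 'I_t -> 'I_B) (mult : 'I_t -> nat) : set tensor_power :=
  [set u | u \in <<[seq monomial a | a in words h mult]>>%VS].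

End TensorPower.

(* Modules are right modules, as for mx_representation (acting on row vectors),
   and are given as subspaces of an ambient vector space. *)
Section Modules.
Variable gT : finGroupType.

Definition is_module (V : lmodType rat) (U : set V) (act : gT -> V -> V) :=
  [/\ U 0 /\ (forall c u v, U u -> U v -> U (c *: u + v)),
      forall g c u v, U u -> U v -> act g (c *: u + v) = c *: act g u + act g v,
      forall g u, U u -> U (act g u),
      forall u, U u -> act 1%g u = u &
      forall g g' u, U u -> act (g * g')%g u = act g' (act g u)].

Definition module_iso (V V' : lmodType rat) (U : set V) (act : gT -> V -> V)
    (U' : set V') (act' : gT -> V' -> V') :=
  [/\ is_module U act, is_module U' act' &
      exists f : {linear V -> V'},
      [/\ forall u v, U u -> U v -> f u = f v -> u = v, f @` U = U' &
          forall g u, U u -> f (act g u) = act' g (f u)]].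

(* The module induced along an injective morphism phi : K -> gT by a
   representation W of K, realised as Hom_K(Q[gT], W). *)
Variables (K : finGroupType) (phi : K -> gT) (d : nat).
Variable W : mx_representation rat [set: K]%SET d.

Definition induced : set {ffun gT -> 'rV[rat]_d} :=
  [set f | forall g k, f (g * phi k)%g = f g *m W k].

Definition induced_act (g : gT) (f : {ffun gT -> 'rV[rat]_d}) :=
  [ffun g' => f (g * g')%g].

End Modules.

Lemma trivial_mx_repr r : mx_repr [set: 'S_r]%SET (fun=> 1%:M : 'M[rat]_1).
Proof. by split=> // s s' _ _; rewrite mulmx1. Qed.

Lemma sign_mx_repr r : mx_repr [set: 'S_r]%SET (fun s => ((-1) ^+ odd_perm s)%:M : 'M[rat]_1).
Proof.
split=> [|s s' _ _]; first by rewrite odd_perm1.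
by rewrite odd_permM signr_addb scalar_mxM.
Qed.

Definition V_eps r d : mx_representation rat [set: 'S_r]%SET 1 :=
  if (r == 1)%N || ~~ odd d then MxRepresentation (trivial_mx_repr r)
  else MxRepresentation (sign_mx_repr r).

Section Young.
Variables (t : nat) (mult : 'I_t -> nat).
Local Notation young_group := {dffun forall i : 'I_t, 'S_(mult i)}.

(* External tensor product of modules of dimension 1. *)
Section Tensor.
Variable W : forall i, mx_representation rat [set: 'S_(mult i)]%SET 1.

Lemma ext_tensor_mx_repr :
  mx_repr [set: young_group]%SET (fun g => (\prod_i W i (g i) 0 0)%:M : 'M[rat]_1).
Proof.
split=> [|g g' _ _].
  by congr (_%:M); apply: big1 => i _; rewrite ffunE repr_mx1 mxE.
rewrite -scalar_mxM -big_split /=; congr (_%:M); apply: eq_bigr => i _.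
by rewrite ffunE repr_mxM ?inE // mxE big_ord1.
Qed.

Definition ext_tensor := MxRepresentation ext_tensor_mx_repr.
End Tensor.

(* g i permutes the i-th block of mult i consecutive integers *)
Definition young_fun (g : young_group) (j : 'I_(\sum_i mult i)%N) :=
  @tagnat.Rank t mult _ (g (tagnat.sig1 j) (tagnat.sig2 j)).

Lemma young_fun_inj g : injective (young_fun g).
Proof.
move=> j j' /tagnat.rank_inj; rewrite /tagnat.sig1 /tagnat.sig2.
move=> e; apply: tagnat.sig_inj; move: e.
case: (tagnat.sig j) (tagnat.sig j') => [i k] [i' k'] /= e.
have ii' : i = i' := congr1 tag e.
case: _ / ii' in k' e *.
by move/eqP: e; rewrite eq_Tagged /= => /eqP/perm_inj ->.
Qed.

Definition young_perm n (mult_sum : (\sum_i mult i)%N = n) (g : young_group) : 'S_n :=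
  cast_perm mult_sum (perm (@young_fun_inj g)).

End Young.

(* The order of the basis is that of the indices, from x_1 = x ord0 to w. *)
Record ordered_basis (R : realType) (T : topologicalType) (m B : nat)
    (x : 'I_B.+1 -> cohomology R T) (deg : 'I_B.+1 -> nat) : Prop := {
  ordered_basisP : is_basis x;
  basis_homogeneous : forall i, homogeneous (deg i) (x i);
  basis_sorted : forall i j : 'I_B.+1, (i <= j)%N -> (deg i <= deg j)%N;
  basis_one : x ord0 = coh_one R T;
  basis_fundamental : fundamental_class m.*2 (x ord_max)
}.

(* Main.v *)
(* The insertions commute up to Koszul signs and 1 is a unit in degree 0, so a
   permutation s sends the word a = x_(a 0) ... x_(a (n - 1)) to the permuted word
   a o s^-1 times the product of the signs (-1)^(|a_i| |a_j|) over the inversions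
   i < j of s; this sign is a cocycle. The words of the given type form a single
   orbit up to sign, that of the word w0 which is constant on the consecutive
   blocks; its stabilizer is the Young subgroup, which acts on w0 through the
   sign of its components on the blocks of odd degree. Hence sending u to the
   function g |-> (coefficient of w0 in g u) is an isomorphism onto the induced
   module. *)
From HB Require Import structures.
Require Import Defs.
From mathcomp Require Import all_boot all_order all_algebra all_fingroup.
From mathcomp Require Import mxrepresentation.
From mathcomp Require Import all_classical all_reals topology normedtype.

Set Implicit Arguments.
Unset Strict Implicit.
Unset Printing Implicit Defensive.

Import Order.TTheory GRing.Theory Num.Theory.

Local Open Scope classical_set_scope.
Local Open Scope ring_scope.

(** * Koszul signs of permutations *)

Section KoszulSign.
Variable n : nat.
Implicit Types (s : 'S_n) (d : 'I_n -> nat).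

(** The action of [s] on two-element subsets, each encoded as an increasing pair. *)
Definition sorted_pair s (p : 'I_n * 'I_n) : 'I_n * 'I_n :=
  if (s p.1 < s p.2)%N then (s p.1, s p.2) else (s p.2, s p.1).

Lemma sorted_pairK s (p : 'I_n * 'I_n) :
  (p.1 < p.2)%N -> sorted_pair s^-1%g (sorted_pair s p) = p.
Proof.
case: p => i j /= ij; rewrite /sorted_pair /=.
by case: (s i < s j)%N => /=; rewrite !permK ?ij // ltnNge ltnW.
Qed.

Lemma sorted_pair_lt s (p : 'I_n * 'I_n) : (p.1 < p.2)%N ->
  ((sorted_pair s p).1 < (sorted_pair s p).2)%N.
Proof.
case: p => i j /= ij; rewrite /sorted_pair; case: ifP => //= /negbT.
rewrite -leqNgt leq_eqVlt val_eqE (inj_eq perm_inj) => /orP[/eqP ji|//].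
by rewrite ji ltnn in ij.
Qed.

(** A symmetric [g] is a function of unordered pairs, and [s] permutes these. *)
Lemma prod_pairs_perm s (g : 'I_n -> 'I_n -> rat) :
  (forall i j, g i j = g j i) ->
  \prod_(p : 'I_n * 'I_n | (p.1 < p.2)%N) g (s p.1) (s p.2) =
  \prod_(p : 'I_n * 'I_n | (p.1 < p.2)%N) g p.1 p.2.
Proof.
move=> gC; rewrite [RHS](reindex_onto (sorted_pair s) (sorted_pair s^-1%g)) /=.
  apply: eq_big => [p|p _]; last by rewrite /sorted_pair; case: ifP.
  apply/idP/andP => [lp|[lsp /eqP <-]]; last exact: sorted_pair_lt.
  by rewrite sorted_pair_lt // sorted_pairK.
by move=> p lp; rewrite -{1}[s]invgK sorted_pairK.
Qed.

(** The sign of reordering a product whose factor [i], of degree [d i], moves to place [s i]: one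
    contribution per inversion of [s]. *)
Definition koszul_sign d s : rat :=
  \prod_(p : 'I_n * 'I_n | (p.1 < p.2)%N)
    (-1) ^+ ((s p.2 < s p.1)%N * (d p.1 * d p.2)).

Lemma koszul_sign1 d : koszul_sign d 1 = 1.
Proof. by apply: big1 => -[i j] /= ij; rewrite !perm1 ltnNge ltnW. Qed.

(** A pair is inverted by [s * s'] iff exactly one of the two steps inverts it. Here [d] gives the
    degrees at the places reached after [s], hence [d \o s] at the start. *)
Lemma koszul_signM d s s' :
  koszul_sign (d \o s) (s * s') = koszul_sign (d \o s) s * koszul_sign d s'.
Proof.
(* The contribution of the unordered pair {i, j} to the sign of [s'], written symmetrically so that
   the product can be reindexed along [s]. *)
pose g (i j : 'I_n) : rat := (-1) ^+
  ((if (i < j)%N then s' j < s' i else s' i < s' j)%N * (d i * d j)).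
have gC i j : g i j = g j i.
  rewrite /g [(d i * d j)%N]mulnC.
  by case: ltngtP => // /val_inj ->.
have -> : koszul_sign d s' = \prod_(p : 'I_n * 'I_n | (p.1 < p.2)%N) g p.1 p.2.
  by apply: eq_bigr => p lp; rewrite /g lp.
rewrite -(prod_pairs_perm s gC) -big_split; apply: eq_bigr => -[i j] /= ij.
rewrite /g !permM -exprD -mulnDl; have sij : s i != s j.
  by rewrite (inj_eq perm_inj); apply: contraTneq ij => ->; rewrite ltnn.
have s'ij : s' (s i) != s' (s j) by rewrite (inj_eq perm_inj).
rewrite -signr_odd -[RHS]signr_odd !oddM oddD.
case: (ltngtP (s i) (s j)) => [_|_|/val_inj e]; first by rewrite !oddb.
  case: (ltngtP (s' (s i)) (s' (s j))) => [//|//|/val_inj e].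
  by rewrite e eqxx in s'ij.
by rewrite e eqxx in sij.
Qed.

Lemma koszul_sign_square d s : koszul_sign d s * koszul_sign d s = 1.
Proof. by rewrite -big_split big1 // => p _ /=; rewrite -expr2 sqrr_sign. Qed.

(* The sign of s is read off the Vandermonde determinant of 0, ..., n - 1,
   whose columns it permutes. *)
Lemma odd_perm_inversions s :
  (-1) ^+ odd_perm s =
  \prod_(p : 'I_n * 'I_n | (p.1 < p.2)%N) (-1) ^+ (s p.2 < s p.1)%N :> rat.
Proof.
pose a : 'rV[rat]_n := \row_i i%:R.
have V_pairs (b : 'rV[rat]_n) : \det (Vandermonde n b) =
    \prod_(p : 'I_n * 'I_n | (p.1 < p.2)%N) (b 0 p.2 - b 0 p.1).
  by rewrite det_Vandermonde pair_big_dep.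
(* Both determinants, for [a] and for its permutation by [s], equal [N] up to sign; [N] is nonzero
   and will be cancelled. *)
pose N := \prod_(p : 'I_n * 'I_n | (p.1 < p.2)%N) `|a 0 p.2 - a 0 p.1|.
have detV : \det (Vandermonde n a) = N.
  rewrite V_pairs; apply: eq_bigr => p lp; rewrite ger0_norm // !mxE subr_ge0.
  by rewrite ler_nat ltnW.
have N0 : N != 0.
  apply/prodf_neq0 => p lp; rewrite normr_eq0 !mxE subr_eq0 eqr_nat.
  by rewrite gtn_eqF.
have detVs : \det (Vandermonde n (col_perm s a)) = (-1) ^+ odd_perm s * N.
  have -> : Vandermonde n (col_perm s a) = col_perm s (Vandermonde n a).
    by apply/matrixP => i j; rewrite !mxE.
  by rewrite col_permE det_mulmx det_perm odd_permV detV mulrC.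
apply: (mulIf N0); rewrite -detVs V_pairs.
rewrite /N -(prod_pairs_perm s (g := fun i j => `|a 0 j - a 0 i|)); last first.
  by move=> i j; rewrite distrC.
rewrite -big_split; apply: eq_bigr => p _; rewrite !mxE [LHS]numEsign.
by rewrite subr_lt0 ltr_nat.
Qed.

End KoszulSign.

(** * The action of permutations on words, computed from the graded product *)

Section TensorAction.
Variables (H : lmodType rat) (mul : H -> H -> H) (B : nat).
Variables (x : 'I_B -> H) (deg : 'I_B -> nat) (e : 'I_B).
Hypotheses (x_basis : is_basis x) (deg_e : deg e = 0%N).
Hypotheses (mul_el : forall i, mul (x e) (x i) = x i).
Hypotheses (mul_er : forall i, mul (x i) (x e) = x i).
Variable n : nat.
Implicit Types (a b : {ffun 'I_n -> 'I_B}) (s : 'S_n) (u : tensor_power B n).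

Definition word_tensor a : tensor_power B n := [ffun b => (b == a)%:R].

Lemma scale_tensorE k u b : (k *: u) b = k * u b.
Proof. by rewrite ffunE. Qed.

Lemma coord_basis i : Defs.coord x (x i) = [ffun j => (j == i)%:R].
Proof.
have xE : x i = \sum_j [ffun j => (j == i)%:R : rat] j *: x j.
  rewrite (bigD1 i) //= big1 => [|j ji]; last first.
    by rewrite ffunE (negbTE ji) scale0r.
  by rewrite ffunE eqxx scale1r addr0.
have [c [_ c_uniq]] := x_basis (x i).
apply: xget_unique => [|c' c'P]; first exact: xE.
by rewrite -(c_uniq _ c'P); apply: c_uniq.
Qed.

Lemma tensor_basis (w : 'I_n -> 'I_B) :
  tensor x (fun j => x (w j)) = word_tensor (finfun w).
Proof.
apply/ffunP => b; rewrite !ffunE.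
under eq_bigr do rewrite coord_basis ffunE.
have [->|/eqP nb] := eqVneq b (finfun w).
  by rewrite big1 // => j _; rewrite ffunE eqxx.
have /existsP[j nj] : [exists j, b j != w j].
  apply: contra_notT nb; rewrite negb_exists => /forallP bw.
  by apply/ffunP => j; rewrite ffunE; apply/eqP; rewrite -[_ == _]negbK.
by rewrite (bigD1 j) //= (negbTE nj) mul0r.
Qed.

Lemma tensor_mul_words a c k :
  tensor_mul mul x deg (word_tensor a) (k *: word_tensor c) =
  (k * koszul deg a c) *: tensor x (fun i => mul (x (a i)) (x (c i))).
Proof.
rewrite /tensor_mul (bigD1 a) //= [X in _ + X]big1 ?addr0; last first.
  move=> b ba; rewrite big1 // => b' _.
  by rewrite ffunE (negbTE ba) !mul0r scale0r.
rewrite (bigD1 c) //= big1 ?addr0 => [|b bc]; last first.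
  by rewrite scale_tensorE [word_tensor c b]ffunE (negbTE bc) !mulr0 mul0r scale0r.
by rewrite scale_tensorE !ffunE !eqxx mul1r mulr1.
Qed.

(** The word reached when only the factors indexed by [r] have been multiplied: letter [a i] at
    place [s i], the unit elsewhere. *)
Definition partial_word s a (r : seq 'I_n) : {ffun 'I_n -> 'I_B} :=
  [ffun j => if s^-1%g j \in r then a (s^-1%g j) else e].

(** Induction on [r], multiplying on the left: the new letter at place [s i] crosses the letters at
    places [s j < s i], each at the cost of a Koszul sign, and units cross freely since their degree
    is 0. *)
Lemma permuted_prefix s a (r : seq 'I_n) :
  pairwise (fun i j : 'I_n => i < j)%N r ->
  \big[tensor_mul mul x deg (n:=n)/tensor_one (x e) x n]_(i <- r)
    insertion (x e) x (s i) (x (a i)) =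
  (\prod_(i <- r) \prod_(j <- r | (i < j)%N)
    (-1) ^+ ((s j < s i)%N * (deg (a i) * deg (a j)))) *:
  word_tensor (partial_word s a r).
Proof.
elim: r => [_|i r IH].
  rewrite !big_nil scale1r /tensor_one tensor_basis; congr word_tensor.
rewrite pairwise_cons => /andP[ir /[dup] rs /IH IHr]; rewrite big_cons IHr.
have r_uniq : uniq r.
  by apply: pairwise_uniq rs => j; apply: ltnn.
have ir' : i \notin r by apply/negP => /(allP ir); rewrite ltnn.
pose v := [ffun j => if j == s i then a i else e].
have -> : insertion (x e) x (s i) (x (a i)) = word_tensor v.
  by rewrite -tensor_basis; congr tensor; apply/funext => j; case: ifP.
rewrite tensor_mul_words.
have -> : (fun j => mul (x (v j)) (x (partial_word s a r j))) =
    (fun j => x (partial_word s a (i :: r) j)).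
  apply/funext => j; rewrite !ffunE inE.
  have -> : (j == s i) = (s^-1%g j == i) by rewrite -[RHS](inj_eq (@perm_inj _ s)) permKV.
  by have [->|_] /= := eqVneq; rewrite ?(negbTE ir') ?mul_er ?mul_el.
rewrite tensor_basis; congr (_ *: word_tensor _); last first.
  by apply/ffunP => j; rewrite ffunE.
rewrite big_cons mulrC; congr (_ * _); last first.
  rewrite big_seq [RHS]big_seq; apply: eq_bigr => j jr.
  by rewrite big_cons ltnNge ltnW // (allP ir).
rewrite big_cons ltnn.
(* Away from [s i] the letters of [v] are units of degree 0, so a single row of the double product
   survives. *)
rewrite /koszul (bigD1 (s i)) //= [X in _ * X]big1 ?mulr1; last first.
  by move=> j jsi; apply: big1 => k _; rewrite ffunE (negbTE jsi) deg_e.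
rewrite ffunE eqxx (reindex_inj (@perm_inj _ s)) /=.
rewrite [RHS]big_seq_cond.
rewrite [RHS](eq_bigl (fun j => j \in r)) => [|j]; last first.
  by rewrite andb_idr // => /(allP ir).
rewrite -[RHS]big_seq (big_uniq _ r_uniq) /= [LHS]big_mkcond [RHS]big_mkcond.
apply: eq_bigr => j _; rewrite ffunE permK.
by case: (s j < s i)%N; case: (j \in r); rewrite ?deg_e ?muln0 ?mul0n ?mul1n.
Qed.

Lemma permuted_monomialE s a : permuted_monomial mul (x e) x deg s a =
  koszul_sign (deg \o a) s *: word_tensor [ffun j => a (s^-1%g j)].
Proof.
(* The enumeration of ['I_n] is increasing, as the prefix formula requires. *)
rewrite /permuted_monomial permuted_prefix; last first.
  rewrite -sorted_pairwise; last by move=> ? ? ?; apply: ltn_trans.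
  have := iota_ltn_sorted 0 n; rewrite -val_enum_ord sorted_map.
  by rewrite enumT [index_enum _]unlock.
congr (_ *: word_tensor _); last by apply/ffunP => j; rewrite !ffunE mem_index_enum.
by rewrite pair_big_dep.
Qed.

Lemma monomialE a : monomial mul (x e) x deg a = word_tensor a.
Proof.
transitivity (permuted_monomial mul (x e) x deg 1 a).
  by apply: eq_bigr => i _; rewrite perm1.
rewrite permuted_monomialE koszul_sign1 scale1r; congr word_tensor.
by apply/ffunP => j; rewrite ffunE invg1 perm1.
Qed.

(** The only word that [s] carries to a multiple of [b] is [b] composed with [s]. *)
Lemma perm_actE s u b : perm_act mul (x e) x deg s u b =
  u [ffun j => b (s j)] * koszul_sign (fun j => deg (b (s j))) s.
Proof.
pose a := [ffun j => b (s j)].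
rewrite /perm_act sum_ffunE (bigD1 a) //= big1 ?addr0 => [|a' a'a]; last first.
  rewrite permuted_monomialE !scale_tensorE ffunE.
  case: eqP => [ba'|_]; last by rewrite !mulr0.
  case/eqP: a'a; apply/ffunP => j; rewrite ffunE.
  by rewrite ba' ffunE permK.
rewrite permuted_monomialE !scale_tensorE ffunE.
have -> : b == [ffun j => a (s^-1%g j)].
  by apply/eqP/ffunP => j; rewrite !ffunE permKV.
rewrite mulr1; congr (_ * koszul_sign _ _).
by apply/funext => j; rewrite /= ffunE.
Qed.

End TensorAction.

(** * The Young subgroup, its character, and the words of a given type *)

Section YoungSubgroup.
Variables (t : nat) (mult : 'I_t -> nat).
Local Notation N := (\sum_i mult i)%N.
Local Notation block := (@tagnat.sig1 t mult).
Local Notation rank_of := (@tagnat.Rank t mult _).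
Local Notation young_group := {dffun forall i : 'I_t, 'S_(mult i)}.
Local Notation young := (young_perm (erefl N)).

Lemma young_permE (g : young_group) j : young g j = young_fun g j.
Proof. by rewrite /young_perm cast_perm_id permE. Qed.

Lemma young_perm_rank (g : young_group) i (q : 'I_(mult i)) :
  young g (rank_of q) = rank_of (g i q).
Proof.
rewrite young_permE /young_fun /tagnat.sig1 /tagnat.sig2 /tagnat.Rank.
by rewrite tagnat.rankK.
Qed.

Lemma block_young_perm (g : young_group) j : block (young g j) = block j.
Proof. by rewrite young_permE tagnat.Rank1K. Qed.

(** Removes the casts that arise because the block of an index is known only up to a propositional
    equality. *)
Lemma rank_cast_ord i i' (e : i' = i) (q : 'I_(mult i')) :
  rank_of (cast_ord (congr1 mult e) q) = rank_of q.
Proof. by case: _ / e; rewrite cast_ord_id. Qed.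

Lemma rank_of_inj i : injective (@tagnat.Rank t mult i).
Proof.
by move=> q q' /(congr1 val)/eqP; rewrite tagnat.eq_Rank eqxx => /eqP/val_inj.
Qed.

Lemma block_stabilizer (s : 'S_N) :
  (forall j, block (s j) = block j) -> exists g, s = young g.
Proof.
move=> sP; have tagP i (q : 'I_(mult i)) : block (s (rank_of q)) = i.
  by rewrite sP tagnat.Rank1K.
(* The restriction of [s] to the block [i], which it preserves. *)
pose f i q := cast_ord (congr1 mult (tagP i q)) (tagnat.sig2 (s (rank_of q))).
have fE i q : rank_of (f i q) = s (rank_of q).
  by rewrite rank_cast_ord tagnat.sig2K.
have f_inj i : injective (f i).
  by move=> q q' /(congr1 (fun r => rank_of r)); rewrite !fE => /perm_inj/rank_of_inj.
exists [ffun i => perm (@f_inj i)]; apply/permP => j.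
by rewrite -[j]tagnat.sig2K young_perm_rank ffunE permE fE.
Qed.

(** Only pairs within one block can be inverted. There the degree is constant: if it is odd each
    inversion contributes -1, and if it is even all contributions are 1. *)
Lemma koszul_sign_young (d : 'I_t -> nat) (g : young_group) :
  koszul_sign (fun j => d (block j)) (young g) =
  \prod_i (if odd (d i) then (-1) ^+ odd_perm (g i) else 1).
Proof.
rewrite /koszul_sign (partition_big (fun p => block p.1) xpredT) //=.
apply: eq_bigr => i _; rewrite (bigID (fun p => block p.2 == i)) /=.
rewrite [X in _ * X]big1 ?mulr1 => [|[j k] /= /andP[/andP[jk /eqP ji] ki]]; last first.
  (* Blocks are consecutive and preserved by [young g], so an inversion of [j < k] would force both
     into the same block. *)
  rewrite ltnNge ltnW //= ltnNge; apply: contra ki => gkj.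
  have := tagnat.le_sig1 gkj; rewrite !block_young_perm ji leEord => kj.
  by rewrite -val_eqE eqn_leq kj -ji; have := tagnat.le_sig1 (ltnW jk).
pose rank2 (q : 'I_(mult i) * 'I_(mult i)) := (rank_of q.1, rank_of q.2).
have rank2_inj : injective rank2.
  move=> [q r] [q' r'] e; congr pair; apply: rank_of_inj.
    exact: (congr1 fst e).
  exact: (congr1 snd e).
pose pairs := finset (fun q : 'I_(mult i) * 'I_(mult i) => q.1 < q.2)%N.
transitivity (\prod_(p in imset rank2 (mem pairs))
    (-1) ^+ ((young g p.2 < young g p.1)%N * (d (block p.1) * d (block p.2))) : rat).
  apply: eq_bigl => -[j k] /=; apply/idP/imsetP => [|[[q r]]]; last first.
    rewrite inE /= => qr [-> ->]; rewrite !tagnat.Rank1K !eqxx !andbT.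
    by have := @tagnat.lt_Rank _ mult i q r; rewrite !ltEord => ->.
  move=> /andP[/andP[jk /eqP ji] /eqP ki].
  exists (cast_ord (congr1 mult ji) (tagnat.sig2 j),
          cast_ord (congr1 mult ki) (tagnat.sig2 k)); last first.
    by rewrite /rank2 !rank_cast_ord !tagnat.sig2K.
  rewrite inE /=; have := @tagnat.lt_Rank _ mult i.
  move=> /(_ (cast_ord (congr1 mult ji) (tagnat.sig2 j))
             (cast_ord (congr1 mult ki) (tagnat.sig2 k))).
  by rewrite !ltEord !rank_cast_ord !tagnat.sig2K jk.
rewrite big_imset /=; last by move=> ? ? _ _; apply: rank2_inj.
case: ifPn => di.
  rewrite odd_perm_inversions; apply: eq_big => [q|q _]; first by rewrite inE.
  rewrite !tagnat.Rank1K !young_perm_rank -signr_odd !oddM di !andbT.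
  have := @tagnat.lt_Rank _ mult i (g i q.2) (g i q.1).
  by rewrite !ltEord => ->; rewrite oddb.
apply: big1 => q _; rewrite !tagnat.Rank1K -signr_odd !oddM (negbTE di).
by rewrite !andbF.
Qed.

(** For [r = 1] the trivial and sign representations agree, the group being trivial, so the parity
    of [d] alone decides. *)
Lemma V_epsE r d (s : 'S_r) :
  V_eps r d s = (if odd d then (-1) ^+ odd_perm s else 1)%:M.
Proof.
rewrite /V_eps; case: eqP => [r1|_] /=; last by case: (odd d).
have -> : s = 1%g by move: s; rewrite r1 => s; apply/permP => j; rewrite !ord1.
by rewrite odd_perm1; case: (odd d).
Qed.

Lemma ext_tensor_V_eps (d : 'I_t -> nat) (g : young_group) :
  ext_tensor (fun i => V_eps (mult i) (d i)) g =
  (koszul_sign (fun j => d (block j)) (young g))%:M.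
Proof.
rewrite koszul_sign_young /=; congr (_%:M); apply: eq_bigr => i _.
by rewrite V_epsE mxE.
Qed.

Section Words.
Variables (B : nat) (h : 'I_t -> 'I_B).
Hypothesis h_inj : injective h.

Definition block_word : {ffun 'I_N -> 'I_B} := [ffun j => h (block j)].

Lemma block_word_in : block_word \in words N h mult.
Proof.
rewrite inE; apply/forallP => i; apply/eqP.
rewrite -[RHS]card_ord -(card_imset _ (@rank_of_inj i)); apply: eq_card => j.
rewrite inE ffunE (inj_eq h_inj); apply/eqP/imsetP => [ji|[q _ ->]]; last first.
  by rewrite tagnat.Rank1K.
by exists (cast_ord (congr1 mult ji) (tagnat.sig2 j));
  rewrite ?rank_cast_ord ?tagnat.sig2K.
Qed.

(** The multiplicities of the letters [h i] already add up to [n], so no place is left for any other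
    letter. *)
Lemma words_count n (a : {ffun 'I_n -> 'I_B}) v :
  N = n -> a \in words n h mult ->
  #|finset (fun j => a j == v)| = (\sum_(i | h i == v) mult i)%N.
Proof.
rewrite inE => Nn /forallP a_words.
have aE i : #|finset (fun j => a j == h i)| = mult i by apply/eqP.
have [/existsP[i /eqP hi]|/existsPn nh] := boolP [exists i, h i == v].
  rewrite (big_pred1 i) => [|i']; first by rewrite -hi aE.
  by rewrite -hi (inj_eq h_inj).
rewrite big_pred0 => [|i]; last exact/negbTE.
apply: eq_card0 => j; rewrite inE; apply/negP => /eqP av.
(* The number of prescribed letters matching place [j]: at most 1, with total [n]. The value 0 at
   the place of a foreign letter would give [n < n]. *)
pose c j := (\sum_i (a j == h i))%N.
have c1 k : (c k <= 1)%N.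
  rewrite /c; have [/existsP[i /eqP ai]|/existsPn na] := boolP [exists i, a k == h i].
    rewrite (bigD1 i) //= big1 ?addn0 ?leq_b1 // => i' i'i.
    by rewrite ai (inj_eq h_inj) eq_sym (negbTE i'i).
  by rewrite big1 // => i _; rewrite (negbTE (na i)).
have cn : (\sum_k c k = n)%N.
  rewrite exchange_big -[RHS]Nn; apply: eq_bigr => i _ /=.
  by rewrite -(aE i) -sum1dep_card [RHS]big_mkcond; apply: eq_bigr => k _; case: eqP.
have cj : c j = 0%N.
  by apply: big1 => i _; rewrite av eq_sym (negbTE (nh i)).
suff : (n < n)%N by rewrite ltnn.
rewrite -{1}cn -[X in (_ < X)%N]card_ord -sum1_card (bigD1 j) //=.
by rewrite [X in (_ < X)%N](bigD1 j) //= cj add0n add1n ltnS leq_sum.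
Qed.

Lemma words_perm n (a : {ffun 'I_n -> 'I_B}) (s : 'S_n) :
  ([ffun j => a (s j)] \in words n h mult) = (a \in words n h mult).
Proof.
rewrite !inE; apply: eq_forallb => i; congr (_ == _).
rewrite -[LHS](card_imset _ (@perm_inj _ s)); apply: eq_card => j.
rewrite inE; apply/imsetP/idP => [[k]|aj].
  by rewrite inE ffunE => ak ->.
by exists (s^-1%g j); rewrite ?inE ?ffunE permKV.
Qed.

(** Words with equal letter counts are rearrangements of each other. *)
Lemma words_orbit (a : {ffun 'I_N -> 'I_B}) : a \in words N h mult ->
  exists s : 'S_N, a = [ffun j => block_word (s j)].
Proof.
move=> a_words; have countE (b : {ffun 'I_N -> 'I_B}) v :
    count_mem v [tuple b j | j < N] = #|finset (fun j => b j == v)|.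
  rewrite /= count_map -sum1_count -sum1dep_card big_enum_cond.
  by apply: eq_bigl => j; rewrite inE.
have /tuple_permP[s sE] : perm_eq [tuple a j | j < N] [tuple block_word j | j < N].
  apply/allP => v _; apply/eqP.
  by rewrite !countE !(words_count _ (erefl N)) // block_word_in.
exists s; apply/ffunP => j.
have := congr1 (fun r => nth (a j) r j) sE.
by rewrite -!tnth_nth !tnth_mktuple => ->; rewrite !ffunE.
Qed.

End Words.
End YoungSubgroup.

(** * The typed span as a space of functions, and the axioms of an action *)

Section TypedSpan.
Variables (H : lmodType rat) (mul : H -> H -> H) (B : nat).
Variables (x : 'I_B -> H) (deg : 'I_B -> nat) (e : 'I_B).
Hypotheses (x_basis : is_basis x) (deg_e : deg e = 0%N).
Hypotheses (mul_el : forall i, mul (x e) (x i) = x i).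
Hypotheses (mul_er : forall i, mul (x i) (x e) = x i).

(** Monomials are the standard basis vectors, so membership is a condition on the support. *)
Lemma typed_spanP n t (h : 'I_t -> 'I_B) mult (u : tensor_power B n) :
  typed_span mul (x e) x deg h mult u <->
  (forall a, a \notin words n h mult -> u a = 0).
Proof.
split=> [u_span a ha|u0]; last first.
  have -> : u = \sum_(a in words n h mult) u a *: monomial mul (x e) x deg a.
    apply/ffunP => a; rewrite sum_ffunE.
    have [ha|ha] := boolP (a \in words n h mult); last first.
      rewrite u0 // big1 // => b hb; rewrite scale_tensorE monomialE // ffunE.
      by case: eqP => [ab|_]; rewrite ?mulr0 // ab hb in ha *.
    rewrite (bigD1 a) //= big1 ?addr0 => [|b /andP[_ ba]].
      by rewrite scale_tensorE monomialE // ffunE eqxx mulr1.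
    by rewrite scale_tensorE monomialE // ffunE eq_sym (negbTE ba) mulr0.
  apply: memv_suml => a ha; apply: memvZ; apply: memv_span.
  by apply: map_f; rewrite mem_enum.
pose s := [seq monomial mul (x e) x deg a | a in words n h mult].
have /coord_span -> : u \in <<in_tuple s>>%VS by exact: u_span.
rewrite sum_ffunE big1 // => i _.
have /mapP[b] : (in_tuple s)`_i \in s by apply: mem_nth.
rewrite mem_enum => hb ->.
rewrite scale_tensorE monomialE // ffunE.
by case: eqP => [ab|_]; rewrite ?mulr0 // ab hb in ha *.
Qed.

Lemma perm_actM n (s s' : 'S_n) (u : tensor_power B n) :
  perm_act mul (x e) x deg (s * s')%g u =
  perm_act mul (x e) x deg s' (perm_act mul (x e) x deg s u).
Proof.
apply/ffunP => b; rewrite !perm_actE //.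
have -> : [ffun j => [ffun j => b (s' j)] (s j)] = [ffun j => b ((s * s')%g j)].
  by apply/ffunP => j; rewrite !ffunE permM.
rewrite -mulrA; congr (_ * _).
have -> : (fun j => deg (b ((s * s')%g j))) = (fun j => deg (b (s' j))) \o s.
  by apply/funext => j; rewrite /= permM.
rewrite koszul_signM; congr (koszul_sign _ _ * _).
by apply/funext => j; rewrite /= ffunE.
Qed.

Lemma perm_act1 n (u : tensor_power B n) : perm_act mul (x e) x deg 1 u = u.
Proof.
apply/ffunP => b; rewrite perm_actE // koszul_sign1 mulr1; congr (u _).
by apply/ffunP => j; rewrite ffunE perm1.
Qed.

Lemma perm_act_linear n (s : 'S_n) c (u v : tensor_power B n) :
  perm_act mul (x e) x deg s (c *: u + v) =
  c *: perm_act mul (x e) x deg s u + perm_act mul (x e) x deg s v.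
Proof.
apply/ffunP => b; rewrite [RHS]ffunE scale_tensorE !perm_actE //.
by rewrite [X in X * _]ffunE scale_tensorE mulrDl mulrA.
Qed.

End TypedSpan.

(** * The map to the induced module *)

Section InducedFunction.
Variables (t : nat) (mult : 'I_t -> nat) (B : nat) (h : 'I_t -> 'I_B).
Variable deg : 'I_B -> nat.
Local Notation N := (\sum_i mult i)%N.
Local Notation w0 := (block_word mult h).

(* The coefficient of w0 in the image of u under g: since w0 is fixed, up to
   sign, by the Young subgroup, it is equivariant under it as a function of g. *)
Definition induced_fun (u : tensor_power B N) : {ffun 'S_N -> 'rV[rat]_1} :=
  [ffun g : 'S_N => (u [ffun j => w0 (g j)] *
    koszul_sign (fun j => deg (w0 (g j))) g)%:M].

Lemma induced_fun_linear : linear induced_fun.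
Proof.
move=> c u v; apply/ffunP => g; rewrite !ffunE -[_ *: u _]/(c * u _).
by rewrite mulrDl -mulrA raddfD /= -scale_scalar_mx.
Qed.

HB.instance Definition _ :=
  GRing.isLinear.Build rat (tensor_power B N) {ffun 'S_N -> 'rV[rat]_1} _
    induced_fun induced_fun_linear.

End InducedFunction.

Lemma induced_is_module (gT K : finGroupType) (phi : K -> gT) d
    (W : mx_representation rat [set: K]%SET d) :
  is_module (induced phi W) (@induced_act gT d).
Proof.
split.
- split=> [g k|c u v uI vI g k]; first by rewrite !ffunE mul0mx.
  by rewrite !ffunE uI vI mulmxDl scalemxAl.
- by move=> g c u v _ _; apply/ffunP => g'; rewrite !ffunE.
- by move=> g u uI g' k; rewrite !ffunE mulgA uI.
- by move=> u _; apply/ffunP => g; rewrite ffunE mul1g.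
- by move=> g g' u _; apply/ffunP => g''; rewrite !ffunE mulgA.
Qed.

(** * Bijectivity and equivariance of this map *)

Section Isomorphism.
Variables (H : lmodType rat) (mul : H -> H -> H) (B : nat).
Variables (x : 'I_B -> H) (deg : 'I_B -> nat) (e : 'I_B).
Hypotheses (x_basis : is_basis x) (deg_e : deg e = 0%N).
Hypotheses (mul_el : forall i, mul (x e) (x i) = x i).
Hypotheses (mul_er : forall i, mul (x i) (x e) = x i).
Variables (t : nat) (mult : 'I_t -> nat) (h : 'I_t -> 'I_B).
Hypothesis h_inj : injective h.
Local Notation N := (\sum_i mult i)%N.
Local Notation w0 := (block_word mult h).
Local Notation W := (ext_tensor (fun i => V_eps (mult i) (deg (h i)))).

Lemma typed_span_is_module n :
  is_module (typed_span mul (x e) x deg h mult : set (tensor_power B n))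
    (perm_act mul (x e) x deg (n := n)).
Proof.
split.
- split=> [|c u v /typed_spanP uS /typed_spanP vS].
    by apply/typed_spanP => // a _; rewrite ffunE.
  apply/typed_spanP => // a ha.
  by rewrite ffunE scale_tensorE uS ?vS // mulr0 addr0.
- by move=> g c u v _ _; apply: perm_act_linear.
- move=> g u /typed_spanP uS; apply/typed_spanP => // a ha.
  by rewrite perm_actE // uS ?mul0r // words_perm.
- by move=> u _; apply: perm_act1.
- by move=> g g' u _; apply: perm_actM.
Qed.

Lemma induced_funE u g : induced_fun h deg u g = (perm_act mul (x e) x deg g u w0)%:M.
Proof. by rewrite ffunE perm_actE. Qed.

Lemma block_word_young g j : w0 (young_perm (erefl N) g j) = w0 j.
Proof. by rewrite !ffunE block_young_perm. Qed.

Lemma koszul_sign_block_word g :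
  W g = (koszul_sign (deg \o w0) (young_perm (erefl N) g))%:M.
Proof.
rewrite (ext_tensor_V_eps (fun i => deg (h i))); congr (koszul_sign _ _)%:M.
by apply/funext => j; rewrite /= ffunE.
Qed.

Lemma induced_funP u : induced (young_perm (erefl N)) W (induced_fun h deg u).
Proof.
move=> g k; rewrite !induced_funE perm_actM // perm_actE // koszul_sign_block_word.
rewrite -scalar_mxM.
have -> : [ffun j => w0 (young_perm (erefl N) k j)] = w0.
  by apply/ffunP => j; rewrite ffunE block_word_young.
have -> // : (fun j => deg (w0 (young_perm (erefl N) k j))) = deg \o w0.
by apply/funext => j; rewrite block_word_young.
Qed.

Lemma typed_span_iso_induced :
  module_iso
    (typed_span mul (x e) x deg h mult : set (tensor_power B N))
    (perm_act mul (x e) x deg (n := N))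
    (induced (young_perm (erefl N)) W) (@induced_act 'S_N 1).
Proof.
split; [exact: typed_span_is_module | exact: induced_is_module |].
exists (induced_fun h deg); split.
(* Injectivity: every word of the type is [w0] composed with some [g], and the value at [g] is the
   coefficient there up to a sign. *)
- move=> u v /typed_spanP uS /typed_spanP vS uv; apply/ffunP => a.
  have [ha|ha] := boolP (a \in words N h mult); last by rewrite uS ?vS.
  have [g ->] := words_orbit h_inj ha.
  have /ffunP/(_ g) := uv; rewrite !ffunE => /(congr1 (fun M : 'rV[rat]_1 => M 0 0)).
  rewrite !mxE !mulr1n.
  move/(congr1 (fun z => z * koszul_sign (fun j => deg (w0 (g j))) g)).
  by rewrite -!mulrA koszul_sign_square !mulr1.
- apply/seteqP; split=> [_ [u _ <-]|f fI]; first exact: induced_funP.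
  (* The preimage of [f]: its coefficient at [w0] composed with [g] is forced by [f g]. A
     representative [g] is picked; words outside the orbit get 0. *)
  pose u : tensor_power B N := [ffun a =>
    if [pick g : 'S_N | a == [ffun j => w0 (g j)]] is Some g
    then f g 0 0 * koszul_sign (fun j => deg (w0 (g j))) g else 0].
  exists u.
    apply/typed_spanP => // a ha; rewrite ffunE; case: pickP => // g /eqP ag.
    by rewrite ag words_perm block_word_in in ha.
  apply/ffunP => g; rewrite ffunE; apply/matrixP => i j; rewrite !ord1 {i j}.
  rewrite mxE mulr1n ffunE; case: pickP => [g' /eqP gg'|/(_ g)]; last by rewrite eqxx.
  have w0g j : w0 (g j) = w0 (g' j) by have /ffunP/(_ j) := gg'; rewrite !ffunE.
  (* The picked [g'] and [g] give the same word, so they differ by an element of the stabilizer of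
     [w0]. Equivariance of [f] and the cocycle identity then make the choice harmless. *)
  have [k kE] : exists k, (g'^-1 * g)%g = young_perm (erefl N) k.
    apply: block_stabilizer => j; apply: h_inj.
    by have := w0g (g'^-1%g j); rewrite permKV permM [w0 (g _)]ffunE [w0 j]ffunE.
  have -> : (fun j => deg (w0 (g j))) = (deg \o w0) \o g'.
    by apply/funext => j; rewrite /= w0g.
  have -> : g = (g' * young_perm (erefl N) k)%g by rewrite -kE mulKVg.
  rewrite koszul_signM fI koszul_sign_block_word mxE big_ord1 mxE mulr1n.
  by rewrite -mulrA [X in _ * X]mulrA koszul_sign_square mul1r.
- by move=> g u _; apply/ffunP => g'; rewrite induced_funE ffunE induced_funE perm_actM.
Qed.

End Isomorphism.

(** * The unit of the cup product and its degree *)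

Section CohomologyUnit.
Variables (R : realType) (T : topologicalType).

Lemma sing_pull_id k (s : sing R T k) : sing_pull k id s = s.
Proof.
case: s => s cs; apply: eq_exist; apply/funext => u /=; congr s.
apply: val_inj => /=; rewrite -[RHS]mulmx1; congr (_ *m _).
apply/matrixP => i j; rewrite !mxE; congr (_%:R).
by rewrite -val_eqE /= inordK.
Qed.

Lemma ev_one k (s : sing R T k) : ev (@one_cochain R T) s = (k == 0)%N%:R.
Proof. by []. Qed.

(** In the Alexander-Whitney sum only the front face of dimension 0 contributes, and its back face
    is the whole simplex. *)
Lemma cup_one_l (y : cohomology R T) : cup (coh_one R T) y = y.
Proof.
rewrite -[y]coh_class_repr; move: (generic_quotient.repr y) => z.
rewrite coh_classM; congr coh_class; apply: val_inj => /=.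
apply/funext => -[k s]; rewrite -!/(ev _ s) ev_cup big_ord_recl big1 ?addr0.
  rewrite ev_one mul1r.
  have -> : sing_pull (k - 0) (addn 0) s = sing_pull (k - 0) id s by [].
  by rewrite subn0 sing_pull_id.
by move=> i _; rewrite ev_one mul0r.
Qed.

Lemma cup_one_r (y : cohomology R T) : cup y (coh_one R T) = y.
Proof.
rewrite -[y]coh_class_repr; move: (generic_quotient.repr y) => z.
rewrite coh_classM; congr coh_class; apply: val_inj => /=.
apply/funext => -[k s]; rewrite -!/(ev _ s) ev_cup big_ord_recr big1 /=.
  by rewrite ev_one subnn mulr1 sing_pull_id add0r.
by move=> i _; rewrite ev_one subn_eq0 leqNgt ltn_ord mulr0.
Qed.

(** Coboundaries vanish on 0-simplices, whereas 1 takes the value 1 on a constant one; a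
    representative in degree [d != 0] would vanish there. *)
Lemma homogeneous_one d : [set: T] !=set0 ->
  homogeneous d (coh_one R T) -> d = 0%N.
Proof.
move=> [p _] [z /coh_classP[c _ dc] zd]; apply/eqP; apply: contraT => d0.
have s : sing R T 0 by exists (fun=> p) => u; apply: cst_continuous.
have := congr1 (fun f => ev f s) dc.
rewrite evd0 (evD (@one_cochain R T) (- val z) s) evN zd; last by rewrite eq_sym.
by rewrite subr0 => /esym/eqP; rewrite oner_eq0.
Qed.

End CohomologyUnit.

(** * Specialization to the cohomology of the variety *)

Lemma decreasing_inj k l (f : 'I_k -> 'I_l) :
  (forall i j : 'I_k, (i < j)%N -> (f j < f i)%N) -> injective f.
Proof.
move=> f_decr i j fij; case: (ltngtP i j) => [/f_decr|/f_decr|/val_inj //].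
  by rewrite fij ltnn.
by rewrite fij ltnn.
Qed.

Theorem proposition3p3 (R : realType) (N m : nat) (hm : (1 <= m)%N)
  (X : set (projective_space R N)) (hX : smooth_projective_variety m X)
  (B : nat) (x : 'I_B.+1 -> cohomology R X) (deg : 'I_B.+1 -> nat)
  (hx : ordered_basis m x deg)
  (n : nat) (hn : (1 <= n)%N)
  (t : nat) (h : 'I_t -> 'I_B.+1)
  (hh : forall i j : 'I_t, (i < j)%N -> (h j < h i)%N)
  (mult : 'I_t -> nat) (hmult : forall i, (1 <= mult i)%N)
  (mult_sum : (\sum_i mult i)%N = n) :
  module_iso
    (typed_span (@cup R X) (coh_one R X) x deg h mult : set (tensor_power B.+1 n))
    (perm_act (@cup R X) (coh_one R X) x deg (n := n))
    (induced (young_perm mult_sum)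
       (ext_tensor (fun i => V_eps (mult i) (deg (h i)))))
    (@induced_act 'S_n 1).
Proof.
have h_inj := decreasing_inj hh.
have [x_basis x_hom _ x_one _] := hx.
(* A point of [X] is what forces the unit class into degree 0. *)
have X_nonempty : [set: X] !=set0.
  by have [_ _ [P XP] _] := hX; exists (SigSub (mem_set XP)).
have deg0 : deg ord0 = 0%N.
  by have := x_hom ord0; rewrite x_one; apply: homogeneous_one.
(* Replacing [n] by the sum of the multiplicities turns the cast in [young_perm] into one along
   [erefl]. *)
case: _ / mult_sum; rewrite -x_one; apply: typed_span_iso_induced => // i.
  by rewrite x_one cup_one_l.
by rewrite x_one cup_one_r.
Qed.
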